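(* Let $G_{j,j'}$, $1\le j,j'\le d$, be complex measures with finite total variation on the torus $[-\pi,\pi)^\nu$, and for all measurable sets $A\subset[-\pi,\pi)^\nu$ let $G(A)=(G_{j,j'}(A))_{1\le j,j'\le d}$. Then the ($\sigma$-additive) matrix valued function $A\mapsto G(A)$ is a positive semidefinite matrix valued, even measure on the torus $[-\pi,\pi)^\nu$ if and only if the matrix $(G_{j,j'}(A))_{1\le j,j'\le d}$ is positive semidefinite and $G_{j,j'}(-A)=\overline{G_{j,j'}(A)}$ for all measurable sets $A\subset[-\pi,\pi)^\nu$ and all $1\le j,j'\le d$.
   Context: The torus $[-\pi,\pi)^\nu$ is obtained by identifying coordinates modulo $2\pi$; measurable means Borel measurable; $-A=\{-x:x\in A\}$. A complex measure has finite total variation if its real and imaginary parts are both differences of two finite measures. Positive semidefinite matrices are understood to be Hermitian. Definition. The matrix valued measure $(G_{j,j'})$ is called a positive semidefinite matrix valued, even measure on the torus if (1) there exists a finite positive measure $\mu$ on $[-\pi,\pi)^\nu$ such that all $G_{j,j'}$ are absolutely continuous with respect to $\mu$ and the matrix of Radon--Nikodym derivatives $(g_{j,j'}(x))_{1\le j,j'\le d}$, $g_{j,j'}=\frac{dG_{j,j'}}{d\mu}$, is positive semidefinite for $\mu$-almost all $x$; and (2) $G_{j,j'}(-A)=\overline{G_{j,j'}(A)}$ for all measurable $A\subset[-\pi,\pi)^\nu$ and $1\le j,j'\le d$. *)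

(* Defs.v *)
From HB Require Import structures.
From mathcomp Require Import all_boot all_order all_algebra.
From mathcomp Require Import sesquilinear spectral.
From mathcomp Require Import all_classical all_reals all_analysis.
From mathcomp Require Import complex.
From mathcomp Require Import ring lra.
Set Implicit Arguments.
Unset Strict Implicit.
Unset Printing Implicit Defensive.
Import Order.TTheory GRing.Theory Num.Theory.
Import numFieldNormedType.Exports.
Local Open Scope classical_set_scope.
Local Open Scope ring_scope.
Local Open Scope charge_scope.
Local Open Scope complex_scope.
Local Open Scope sesquilinear_scope.

Section Torus.
Variables (R : realType) (nu : nat).

Definition torus_space := {x : 'rV[R]_nu | [forall i, - pi <= x 0 i < pi]}.

HB.instance Definition _ := Choice.copy torus_space
  {x : 'rV[R]_nu | [forall i, - pi <= x 0 i < pi]}.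

(* The representative in [-pi, pi[ of the class of x modulo 2 pi. *)
Definition mod_2pi (x : R) : R :=
  x - (Num.floor ((x + pi) / (2 * pi)))%:~R * (2 * pi).

Lemma mod_2pi_itv (x : R) : - pi <= mod_2pi x < pi.
Proof.
have pi0 : 0 < 2 * pi :> R by rewrite mulr_gt0// pi_gt0.
have /andP[] := floor_itv ((x + pi) / (2 * pi)).
rewrite /mod_2pi; set k := Num.floor _.
rewrite intrD1 ler_pdivlMr// ltr_pdivrMr// mulrDl mul1r => k_le k_gt.
by apply/andP; split; lra.
Qed.

Lemma torus_proj_subproof (x : 'rV[R]_nu) :
  [forall i, - pi <= (map_mx mod_2pi x) 0 i < pi].
Proof. by apply/forallP => i; rewrite mxE mod_2pi_itv. Qed.

Definition torus_proj (x : 'rV[R]_nu) : torus_space :=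
  exist _ (map_mx mod_2pi x) (torus_proj_subproof x).

HB.instance Definition _ := isPointed.Build torus_space (torus_proj 0).

(* The topology of the torus is the quotient topology of R^nu, in which -pi
   and pi are identified; it is not the subspace topology of [-pi, pi[^nu. *)
Definition torus_open (U : set torus_space) := open (torus_proj @^-1` U).

Lemma torus_openT : torus_open setT.
Proof. by rewrite /torus_open preimage_setT; exact: openT. Qed.

Lemma torus_openI : setI_closed torus_open.
Proof. by move=> U V oU oV; exact: openI. Qed.

Lemma torus_open_bigcup (I : Type) (f : I -> set torus_space) :
  (forall i, torus_open (f i)) -> torus_open (\bigcup_i f i).
Proof.
by move=> of_; rewrite /torus_open preimage_bigcup; apply: bigcup_open => i _;
  exact: of_.
Qed.

HB.instance Definition _ := isOpenTopological.Build torus_space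
  torus_openT torus_openI torus_open_bigcup.

Definition torus := g_sigma_algebraType (@open torus_space).

HB.instance Definition _ :=
  Measurable.copy torus (g_sigma_algebraType (@open torus_space)).

Definition torus_opp (x : torus) : torus :=
  torus_proj (- sval (x : torus_space)).

Definition torus_oppset (A : set torus) : set torus := torus_opp @` A.

End Torus.

Section ComplexMeasure.
Context {disp : measure_display} {T : measurableType disp} {R : realType}.

Record complex_measure := ComplexMeasure {
  re_part : {charge set T -> \bar R};
  im_part : {charge set T -> \bar R} }.

(* Charges take finite values on measurable sets, where [fine] loses nothing. *)
Definition complex_measure_fun (G : complex_measure) (A : set T) : R[i] :=
  fine (re_part G A) +i* fine (im_part G A).

Coercion complex_measure_fun : complex_measure >-> Funclass.

Definition finite_measure_difference (m : {charge set T -> \bar R}) : Prop :=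
  exists m1 m2 : {finite_measure set T -> \bar R},
    forall A, measurable A -> m A = (m1 A - m2 A)%E.

Definition finite_total_variation (G : complex_measure) : Prop :=
  finite_measure_difference (re_part G) /\
  finite_measure_difference (im_part G).

Definition complex_dominates (G : complex_measure)
    (mu : {finite_measure set T -> \bar R}) : Prop :=
  re_part G `<< mu /\ im_part G `<< mu.

(* The Radon-Nikodym derivative of a charge dominated by mu is finite
   everywhere, so [fine] loses nothing here either. *)
Definition complex_RN (G : complex_measure)
    (mu : {finite_measure set T -> \bar R}) (x : T) : R[i] :=
  fine (('d (re_part G) '/d mu) x) +i* fine (('d (im_part G) '/d mu) x).

End ComplexMeasure.
Arguments complex_measure {disp} T R.

Definition possemidefmx (C : numClosedFieldType) (d : nat) (M : 'M[C]_d) : Prop :=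
  M \is hermsymmx /\ forall z : 'cV[C]_d, 0 <= (z ^t* *m M *m z) 0 0.

Section MatrixMeasure.
Variables (R : realType) (nu d : nat).
Variable G : 'I_d -> 'I_d -> complex_measure (torus R nu) R.

Definition matrix_measure (A : set (torus R nu)) : 'M[R[i]]_d :=
  \matrix_(j, j') G j j' A.

Definition even_measure_on (A : set (torus R nu)) : Prop :=
  forall j j', G j j' (torus_oppset A) = (G j j' A)^*.

Definition psd_even_matrix_measure : Prop :=
  (exists mu : {finite_measure set (torus R nu) -> \bar R},
     (forall j j', complex_dominates (G j j') mu) /\
     {ae mu, forall x,
        possemidefmx (\matrix_(j, j') complex_RN (G j j') mu x)}) /\
  (forall A, measurable A -> even_measure_on A).

End MatrixMeasure.

(* Main.v *)
(* A complex matrix is positive semidefinite iff it lies in countably many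
   closed half-spaces [0 <= Re tr(K M)], namely those given by the K with entries
   in Q(i) that lie in the dual of the positive semidefinite cone. For each fixed
   K, [Re tr(K G(A))] is the integral over A of [Re tr(K g)], so it is nonnegative
   for all A iff [Re tr(K g) >= 0] almost everywhere; the countably many null sets
   can be discarded together. Hence G(A) is positive semidefinite for all A iff g
   is so almost everywhere, for any dominating mu, and such a mu is obtained by
   adding up the finite measures whose differences are the entries of G. *)

Require Import Defs.
From HB Require Import structures.
From mathcomp Require Import all_boot all_order all_algebra.
From mathcomp Require Import all_classical all_reals all_analysis.
From mathcomp Require Import measurable_realfun.
From mathcomp Require Import complex.
From mathcomp Require Import ring lra.
Set Implicit Arguments.
Unset Strict Implicit.
Unset Printing Implicit Defensive.
Import Order.TTheory GRing.Theory Num.Theory.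
Import numFieldNormedType.Exports.
Local Open Scope classical_set_scope.
Local Open Scope ring_scope.

(** * The sum of two finite measures as a finite measure *)

Section FiniteMeasureAdd.
Context {disp : measure_display} {T : measurableType disp} {R : realType}.
Variables m1 m2 : {finite_measure set T -> \bar R}.

HB.instance Definition _ := Measure.copy (measure_add m1 m2)
  (msum (fun n => if n is 0%N then m1 : {measure set T -> \bar R} else m2) 2).

Let measure_add_fin_num : fin_num_fun (measure_add m1 m2).
Proof. by move=> A mA; rewrite measure_addE fin_numD !fin_num_measure. Qed.

HB.instance Definition _ :=
  Measure_isFinite.Build _ _ _ (measure_add m1 m2) measure_add_fin_num.

End FiniteMeasureAdd.

(** * Real densities with respect to a finite measure *)

Section Density.
Local Open Scope charge_scope.
Context {disp : measure_display} {T : measurableType disp} {R : realType}.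
Implicit Types (mu : {finite_measure set T -> \bar R}) (f g : T -> R).
Implicit Types (c : set T -> R).

(** The set function [c] is a bare real-valued function, so real linear combinations of the [fine]
    values of charges need no charge structure. *)
Definition is_density mu f c :=
  mu.-integrable setT (EFin \o f) /\
  forall A, measurable A -> (\int[mu]_(x in A) (f x)%:E = (c A)%:E)%E.

Lemma is_density0 mu : is_density mu (fun=> 0) (fun=> 0).
Proof.
by split=> [|A mA]; [exact: integrable0 | rewrite integral0_eq].
Qed.

Lemma is_densityD mu f g c1 c2 : is_density mu f c1 -> is_density mu g c2 ->
  is_density mu (fun x => f x + g x) (fun A => c1 A + c2 A).
Proof.
move=> [fi fE] [gi gE]; split=> [|A mA].
  exact: (integrableD measurableT fi gi).
under eq_integral do rewrite EFinD.
have sub h : mu.-integrable setT h -> mu.-integrable A h.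
  by apply: integrableS.
by rewrite integralD ?fE ?gE//; exact: sub.
Qed.

Lemma is_densityZ mu f c k : is_density mu f c ->
  is_density mu (fun x => k * f x) (fun A => k * c A).
Proof.
move=> [fi fE]; split=> [|A mA].
  exact: (integrableZl measurableT k fi).
under eq_integral do rewrite EFinM.
rewrite integralZl ?fE//; exact: integrableS fi.
Qed.

Lemma is_density_sum mu (I : Type) (r : seq I) (f : I -> T -> R)
    (c : I -> set T -> R) : (forall i, is_density mu (f i) (c i)) ->
  is_density mu (fun x => \sum_(i <- r) f i x) (fun A => \sum_(i <- r) c i A).
Proof.
move=> fc; elim: r => [|i r IH].
  under eq_fun do rewrite big_nil.
  by under [X in is_density _ _ X]eq_fun do rewrite big_nil; exact: is_density0.
under eq_fun do rewrite big_cons.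
under [X in is_density _ _ X]eq_fun do rewrite big_cons.
exact: is_densityD.
Qed.

(** On [N], where [f] is negative, the integral of [|f|] is [- c N], which is at most 0 if [c] is
    nonnegative. So [f] vanishes almost everywhere on [N], which contradicts its sign unless [N] is
    null. *)
Lemma is_density_ge0P mu f c : is_density mu f c ->
  (forall A, measurable A -> 0 <= c A) <-> {ae mu, forall x, 0 <= f x}.
Proof.
move=> [fi fE]; have mf := measurable_int mu fi.
split=> [c0|f0 A mA].
  pose N := [set x | (f x)%:E < 0]%E.
  have mN : measurable N.
    by rewrite -[N]setTI; exact: (emeasurable_fun_infty_o measurableT mf).
  have mfN := measurable_funTS mf : measurable_fun N _.
  have : ae_eq mu N (EFin \o f) (cst 0%E).
    apply/ae_eq_integral_abs => //; apply/eqP; rewrite eq_le integral_ge0// andbT.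
    rewrite (_ : (\int[mu]_(x in N) _ = - \int[mu]_(x in N) (f x)%:E)%E).
      by rewrite fE// leeNl oppe0 lee_fin c0.
    rewrite -integralN/=; last first.
      apply: (integrable_add_def mN).
      exact: (integrableS measurableT mN (@subsetT _ _) fi).
    apply: eq_integral => x; rewrite inE /N/= lte_fin => fx0.
    by rewrite ltr0_norm.
  apply: filterS => x Nfx; rewrite leNgt; apply/negP => fx0.
  by have := Nfx fx0; case=> fx; rewrite fx ltxx in fx0.
rewrite -lee_fin -fE//.
have mfA := measurable_funTS mf : measurable_fun A _.
(* Almost everywhere [f] equals its positive part, whose integral is nonnegative. *)
rewrite (@ae_eq_integral _ _ _ mu A (EFin \o (fun x => Num.max (f x) 0)))//.
- by apply: integral_ge0 => x _; rewrite lee_fin le_max lexx orbT.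
- apply/measurable_EFinP; apply: measurable_maxr => //.
  exact/measurable_EFinP.
- by apply: filterS f0 => x fx0 _ /=; rewrite max_l.
Qed.

Lemma is_density_Radon_Nikodym mu (nu : {charge set T -> \bar R}) :
  nu `<< mu -> is_density mu (fun x => fine (('d nu '/d mu) x))
                             (fun A => fine (nu A)).
Proof.
move=> numu.
have dE : EFin \o (fun x => fine (('d nu '/d mu) x)) = 'd nu '/d mu.
  by apply/funext => x /=; rewrite fineK// Radon_Nikodym_fin_num.
split=> [|A mA]; first by rewrite dE; exact: Radon_Nikodym_integrable.
rewrite fineK ?fin_num_measure// (Radon_Nikodym_integral numu)//.
by apply: eq_integral => x _; rewrite -[RHS](congr1 (@^~ x) dE).
Qed.

Lemma ae_forall_countable mu (I : countType) (P : I -> T -> Prop) :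
  {ae mu, forall x, forall i, P i x} <-> forall i, {ae mu, forall x, P i x}.
Proof.
split=> [aeP i|aeP]; first by apply: filterS aeP => x; exact.
(* Conditions are reindexed by natural numbers; codes of no element get the trivial condition. *)
pose Q n x := if unpickle n is Some i then P i x else True.
have /ae_foralln : forall n, {ae mu, forall x, Q n x}.
  by move=> n; rewrite /Q; case: unpickle => [i|]; [exact: aeP | exact: aeW].
by apply: filterS => x Qx i; have := Qx (pickle i); rewrite /Q pickleK.
Qed.

Lemma finite_measure_difference_dominated (I : eqType) (s : seq I)
    (nu : I -> {charge set T -> \bar R}) :
  (forall i, finite_measure_difference (nu i)) ->
  exists mu, forall i, i \in s -> nu i `<< mu.
Proof.
move=> nu_diff.
elim: s => [|i s [mu IH]]; first by exists mzero.
have [m1 [m2 nuE]] := nu_diff i.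
(* A null set of a sum of measures is null for each summand, hence for the difference [m1 - m2]. *)
pose m := measure_add (measure_add m1 m2) mu.
have add0 (x y : \bar R) : (0 <= x -> 0 <= y -> x + y = 0 -> x = 0 /\ y = 0)%E.
  by move=> x0 y0 /eqP; rewrite padde_eq0// => /andP[/eqP ? /eqP].
exists m => j; have null A : measurable A -> m A = 0%E ->
    [/\ m1 A = 0, m2 A = 0 & mu A = 0]%E.
  move=> mA; rewrite /m measure_addE.
  move=> /(add0 _ _ (measure_ge0 _ _) (measure_ge0 _ _))[].
  rewrite /= measure_addE.
  by move=> /(add0 _ _ (measure_ge0 _ _) (measure_ge0 _ _))[].
rewrite in_cons => /predU1P[->|js];
  apply/null_content_dominatesP => A mA /(null _ mA)[m10 m20 mu0].
  by rewrite nuE// m10 m20 sube0.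
by have /null_content_dominatesP := IH j js; exact.
Qed.

End Density.

(** * The positive semidefinite cone as a countable intersection of half-spaces *)

Section PositiveSemidefinite.
Local Open Scope sesquilinear_scope.
Variables (R : realType) (d : nat).
Implicit Types (K M : 'M[R[i]]_d) (z : 'cV[R[i]]_d).

(** This is Re tr(K M), expanded so that it is visibly a real linear combination of the real and
    imaginary parts of the entries of [M]. *)
Definition re_pairing K M : R :=
  \sum_i \sum_j (complex.Re (K i j) * complex.Re (M j i) -
                  complex.Im (K i j) * complex.Im (M j i)).

Lemma re_pairingE K M : re_pairing K M = complex.Re (\tr (K *m M)).
Proof.
have Re_sum (F : 'I_d -> R[i]) :
    complex.Re (\sum_i F i) = \sum_i complex.Re (F i).
  by apply: (big_morph (@complex.Re R)) => // -[a b] [a' b'].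
rewrite Re_sum; apply: eq_bigr => i _; rewrite mxE Re_sum.
by apply: eq_bigr => j _; case: (K i j) (M j i) => [a b] [a' b'].
Qed.

Lemma re_pairing_rank1 z M :
  re_pairing (z *m z ^t*) M = complex.Re ((z ^t* *m M *m z) 0 0).
Proof. by rewrite re_pairingE -mulmxA mxtrace_mulC [\tr _]trace_mx11. Qed.

Lemma possemidefmxP M :
  possemidefmx M <-> (forall i j, M j i = (M i j)^*) /\
    forall z, 0 <= re_pairing (z *m z ^t*) M.
Proof.
split=> [[/is_hermitianmxP Mherm Mge0]|[Mherm Mge0]].
  split=> [i j|z].
    by rewrite [in LHS]Mherm expr0 scale1r !mxE.
  by rewrite re_pairing_rank1; have := Mge0 z; rewrite lecE => /andP[].
have MtE : M ^t* = M by apply/matrixP => i j; rewrite !mxE -Mherm.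
split=> [|z]; first by apply/is_hermitianmxP; rewrite expr0 scale1r MtE.
set w := _ *m z.
have wE : w ^t* = w.
  rewrite /w !(trmx_mul, map_mxM) MtE mulmxA; congr (_ *m _ *m _).
  by apply/matrixP => i j; rewrite !mxE; exact: conjCK.
rewrite lecE -re_pairing_rank1 Mge0 andbT.
(* The quadratic form of a Hermitian matrix is real, so the sign of its real part decides. *)
have : (w 0 0)^* = w 0 0 by rewrite -[in RHS]wE !mxE.
by clearbody w; case: (w 0 0) => a b [] /= /eqP; rewrite eqNr.
Qed.

Lemma cvg_ratr_seq (x : R) :
  exists q : nat -> rat, ratr (q n) @[n --> \oo] --> x.
Proof.
have /choice[q qx] (n : nat) : exists q : rat, `|x - ratr q| < n.+1%:R^-1.
  have : x - n.+1%:R^-1 < x + n.+1%:R^-1.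
    by rewrite ltrBlDr -addrA ltrDl addr_gt0// invr_gt0.
  move=> /rat_in_itvoo[q]; rewrite in_itv/= -ltr_distl distrC => qx.
  by exists q.
exists q; apply/cvgrPdist_lt => e e0; near=> n.
apply: lt_trans (qx n) _; near: n; exact: near_infty_natSinv_lt (PosNum e0).
Unshelve. all: by end_near. Qed.

(* Q(i) is encoded as [rat * rat]. *)
Definition ratc (q : rat * rat) : R[i] := (ratr q.1 +i* ratr q.2)%C.

Lemma re_pairing_cvg (K : nat -> 'M[R[i]]_d) (L M : 'M[R[i]]_d) :
  (forall i j, complex.Re (K n i j) @[n --> \oo] --> complex.Re (L i j)) ->
  (forall i j, complex.Im (K n i j) @[n --> \oo] --> complex.Im (L i j)) ->
  re_pairing (K n) M @[n --> \oo] --> re_pairing L M.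
Proof.
move=> ReK ImK; rewrite /re_pairing.
apply: cvg_big => [|i _]; first exact: add_continuous.
apply: cvg_big => [|j _]; first exact: add_continuous.
by apply: cvgB; apply: cvgM => //; apply: cvg_cst.
Qed.

Lemma mxtrace_delta_mul i j M : \tr (delta_mx i j *m M) = M j i.
Proof.
rewrite -(mul_delta_mx (0 : 'I_1)) -mulmxA mxtrace_mulC trace_mx11.
by rewrite -mulmxA -colE -rowE !mxE.
Qed.

(** For Hermitian [M] the right-hand side is the real part of a number minus its conjugate, hence 0.
    These matrices therefore lie in the dual cone for every [c] and can test Hermitian symmetry. *)
Lemma re_pairing_herm (c : R[i]) i j M :
  re_pairing (c *: delta_mx i j - c^* *: delta_mx j i) M =
  complex.Re (c * M j i - c^* * M i j).
Proof.
by rewrite re_pairingE mulmxBl -!scalemxAl linearB !linearZ/= !mxtrace_delta_mul.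
Qed.

(** Two kinds of [K] suffice for the converse: skew-Hermitian ones with two opposite entries force
    symmetry, and rank-one ones built from vectors over Q(i) give the quadratic form by density. *)
Lemma possemidefmx_countable M : possemidefmx M <->
  forall K : {ffun 'I_d * 'I_d -> rat * rat},
    let K' := \matrix_(i, j) ratc (K (i, j)) in
    (forall N, possemidefmx N -> 0 <= re_pairing K' N) -> 0 <= re_pairing K' M.
Proof.
split=> [Mpsd K K'|MK]; first exact.
have {}MK (L : 'M[R[i]]_d) (q : 'I_d -> 'I_d -> rat * rat) :
    (forall i j, L i j = ratc (q i j)) ->
    (forall N, possemidefmx N -> 0 <= re_pairing L N) -> 0 <= re_pairing L M.
  move=> Lq; have -> : L = \matrix_(i, j) ratc ([ffun p => q p.1 p.2] (i, j)).
    by apply/matrixP => i j; rewrite mxE ffunE Lq.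
  exact: MK.
apply/possemidefmxP; split=> [i j|z].
  have herm (c : rat * rat) :
      0 <= complex.Re (ratc c * M j i - (ratc c)^* * M i j).
    (* [c'] encodes minus the conjugate of [c]; the two terms below add up when [i = j]. *)
    rewrite -re_pairing_herm; pose c' := (- c.1, c.2).
    apply: (MK _ (fun k l => c *+ ((k == i) && (l == j)) +
                             c' *+ ((k == j) && (l == i)))) => [k l|N].
      rewrite !mxE /ratc; do 2![case: (_ && _)];
        rewrite ?mulr1 ?mulr0 ?mulr1n ?mulr0n/= ?rmorphD ?rmorphN ?rmorph0;
        by simpc.
    move=> /possemidefmxP[Nherm _]; rewrite re_pairing_herm (Nherm i j).
    by case: (ratc c) (N i j) => a b [a' b'] /=; lra.
  (* The values 1 and -1 make the real parts of [M i j] and [M j i] equal; i and -i make the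
     imaginary parts opposite. *)
  have := (herm (1, 0), herm (-1, 0), herm (0, 1), herm (0, -1)).
  rewrite /ratc/= !rmorphN !rmorph1 !rmorph0.
  case: (M i j) (M j i) => a b [a' b'] /= [[[h1 h2] h3] h4].
  by apply/eqP; rewrite eq_complex/=; apply/andP; split; apply/eqP; lra.
have /choice[q qz] i := cvg_ratr_seq (complex.Re (z i 0)).
have /choice[p pz] i := cvg_ratr_seq (complex.Im (z i 0)).
(* Vectors over Q(i) converging to [z]; nonnegativity passes to the limit. *)
pose u n : 'cV[R[i]]_d := \col_i ratc (q i n, p i n).
apply: (@cvgr_to_ge _ \oo _ _ (fun n => re_pairing (u n *m (u n) ^t*) M)).
  apply: re_pairing_cvg => i j.
    apply: (@cvg_trans _
      (ratr (q i n) * ratr (q j n) + ratr (p i n) * ratr (p j n) @[n --> \oo])).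
      apply: near_eq_cvg; apply: nearW => n.
      by rewrite !mxE big_ord1 !mxE /=; simpc.
    rewrite !mxE big_ord1 !mxE.
    move: (qz i) (qz j) (pz i) (pz j); case: (z i 0) (z j 0) => a b [a' b'] /=.
    move=> qi qj pi pj; rewrite mulrN opprK.
    by apply: cvgD; exact: cvgM.
  apply: (@cvg_trans _
    (ratr (p i n) * ratr (q j n) - ratr (q i n) * ratr (p j n) @[n --> \oo])).
    apply: near_eq_cvg; apply: nearW => n.
    by rewrite !mxE big_ord1 !mxE /=; rewrite mulrN addrC.
  rewrite !mxE big_ord1 !mxE.
  move: (qz i) (qz j) (pz i) (pz j); case: (z i 0) (z j 0) => a b [a' b'] /=.
  move=> qi qj pi pj; rewrite mulrN addrC.
  by apply: cvgB; exact: cvgM.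
apply: nearW => n.
(* The entries of [u n *m (u n) ^t*], which stay in Q(i). *)
apply: (MK _ (fun i j => (q i n * q j n + p i n * p j n,
                          p i n * q j n - q i n * p j n))) => [i j|N].
  rewrite !mxE big_ord1 !mxE /ratc/= rmorphD rmorphB !rmorphM.
  by apply/eqP; rewrite eq_complex/=; apply/andP; split; apply/eqP; ring.
by move=> /possemidefmxP[].
Qed.

End PositiveSemidefinite.

(** * Positivity of a matrix measure and of its density *)

Section MatrixDensity.
Context {disp : measure_display} {T : measurableType disp} {R : realType}.
Variables (d : nat) (mu : {finite_measure set T -> \bar R}).
Variable G : 'I_d -> 'I_d -> complex_measure T R.
Hypothesis G_mu : forall j j', complex_dominates (G j j') mu.

Let matrixRN x : 'M[R[i]]_d := \matrix_(j, j') complex_RN (G j j') mu x.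
Let matrixG A : 'M[R[i]]_d := \matrix_(j, j') G j j' A.

(** [re_pairing K] is real-linear, so the Radon-Nikodym densities of the entries combine. *)
Lemma is_density_re_pairing (K : 'M[R[i]]_d) :
  is_density mu (fun x => re_pairing K (matrixRN x))
                (fun A => re_pairing K (matrixG A)).
Proof.
apply: is_density_sum => i; apply: is_density_sum => j.
have [reG imG] := G_mu j i.
under eq_fun do rewrite !mxE/= -mulNr.
under [X in is_density _ _ X]eq_fun do rewrite !mxE/= -mulNr.
by apply: is_densityD; apply: is_densityZ; exact: is_density_Radon_Nikodym.
Qed.

Lemma ae_possemidefmx_RN : {ae mu, forall x, possemidefmx (matrixRN x)} <->
  forall A, measurable A -> possemidefmx (matrixG A).
Proof.
split=> [psd A mA|psd].
  apply/possemidefmx_countable => K K' dual.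
  have := is_density_ge0P (is_density_re_pairing K').
  move=> /iffRL; apply => //.
  by apply: filterS psd => x; exact: dual.
have : {ae mu, forall x, forall K : {ffun 'I_d * 'I_d -> rat * rat},
    let K' := \matrix_(i, j) ratc R (K (i, j)) in
    (forall N, possemidefmx N -> 0 <= re_pairing K' N) ->
    0 <= re_pairing K' (matrixRN x)}.
  apply/ae_forall_countable => K /=; set K' := \matrix_(i, j) _.
  (* A [K] outside the dual cone imposes no condition. *)
  have [dual|ndual] := pselect (forall N, possemidefmx N ->
    0 <= re_pairing K' N); last exact: aeW.
  have := is_density_ge0P (is_density_re_pairing K').
  move=> /iffLR/(_ (fun A mA => dual _ (psd A mA))).
  by apply: filterS => x.
by apply: filterS => x /possemidefmx_countable.
Qed.

End MatrixDensity.

Theorem lemma2p3 (R : realType) (nu d : nat)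
    (G : 'I_d -> 'I_d -> complex_measure (torus R nu) R)
    (G_ftv : forall j j', finite_total_variation (G j j')) :
  psd_even_matrix_measure G <->
  (forall A : set (torus R nu), measurable A ->
     possemidefmx (matrix_measure G A) /\
     forall j j', G j j' (torus_oppset A) = (G j j' A)^*).
Proof.
split=> [[[mu [G_mu psd]] ev] A mA|GP].
  split; last exact: ev.
  exact: (ae_possemidefmx_RN G_mu).1 psd A mA.
split; last by move=> A /GP[].
(* All real and imaginary parts form one finite family, so that a single [mu] dominates them. *)
pose part (k : 'I_d * 'I_d * bool) := let: (j, j', b) := k in
  if b then re_part (G j j') else im_part (G j j').
have part_diff k : finite_measure_difference (part k).
  by case: k => [[j j'] []]; have [] := G_ftv j j'.
have [mu part_mu] := finite_measure_difference_dominated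
  (enum {: 'I_d * 'I_d * bool}) part_diff.
have {}part_mu k : part k `<< mu by apply: part_mu; rewrite mem_enum.
have G_mu j j' : complex_dominates (G j j') mu.
  by split; [exact: (part_mu (j, j', true)) | exact: (part_mu (j, j', false))].
exists mu; split => //.
by apply/(ae_possemidefmx_RN G_mu) => A /GP[].
Qed.
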